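(* For every positive integer $n$, there exists a positive integer $k$ such that $\nu(k)=n$.
   Context: Let $F(x,y,z)=x^3+y^3+z^3-3xyz$. For a positive integer $m$, $\nu(m)$ denotes the number of triples of integers $(x,y,z)$ with $0\leq x\leq y\leq z$ and $z\geq x+1$ such that $F(x,y,z)=m$. *)

(* Defs.v *)
From HB Require Import structures.
From mathcomp Require Import all_boot all_order all_algebra finmap.
From mathcomp Require Import boolp classical_sets functions cardinality.
From mathcomp Require Import zify ring lra.

Set Implicit Arguments.
Unset Strict Implicit.
Unset Printing Implicit Defensive.

Import Order.TTheory GRing.Theory Num.Theory.
Local Open Scope classical_set_scope.
Local Open Scope ring_scope.

Definition F (x y z : int) : int :=
  x ^+ 3 + y ^+ 3 + z ^+ 3 - 3%:Z * x * y * z.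

Definition representations (m : nat) : set (int * int * int) :=
  [set t | let: (x, y, z) := t in
    [/\ 0 <= x, x <= y, y <= z, x + 1 <= z & F x y z = m%:Z]].

(* [fset_set] sends an infinite set to the empty one; this never happens
   here, by [finite_representations] below. *)
Definition nu (m : nat) : nat := #|` fset_set (representations m)|.

Lemma representation_bound (m : nat) (x y z : int) :
  representations m (x, y, z) -> z <= m%:Z.
Proof.
move=> [x0 xy yz xz <-].
pose a := y - x; pose b := z - y.
have a0 : 0 <= a by rewrite subr_ge0.
have b0 : 0 <= b by rewrite subr_ge0.
have ab : 1 <= a + b by rewrite /a /b; lia.
have -> : F x y z = (x + y + z) * (a ^+ 2 + a * b + b ^+ 2).
  by rewrite /F /a /b; ring.
have q1 : 1 <= a ^+ 2 + a * b + b ^+ 2 by nia.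
have sz : z <= x + y + z by lia.
apply: (le_trans sz); apply: ler_peMr => //; lia.
Qed.

Lemma finite_representations (m : nat) : finite_set (representations m).
Proof.
pose I : set int := [set k%:Z | k in `I_m.+1].
have finI : finite_set I by apply: finite_image; exact: finite_II.
apply: (@sub_finite_set _ _ (I `*` I `*` I)); last first.
  by apply: finite_setX => //; exact: finite_setX.
move=> [[x y] z] h; have zm := representation_bound h.
case: h => x0 xy yz _ _.
have inI (u : int) : 0 <= u -> u <= m%:Z -> I u.
  by move=> u0 um; exists `|u|%N => /=; lia.
by do ![split] => /=; apply: inI; lia.
Qed.

(* Main.v *)
(* [F x y z = (x + y + z) * N (y - x) (z - y)] with [N a b = a^2 + a b + b^2].
   If [F x y z] is a power of 8, both factors are powers of 2.  Either the
   second one is 1, so that [(y - x, z - y)] is [(1, 0)] or [(0, 1)]; the class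
   of the power modulo 3 decides which, and [x] is then determined.  Or it is
   even, which forces [x], [y], [z] to be even.  Hence the representations of
   [8^(n+1)] are the doubles of those of [8^n], plus one with odd second factor,
   and [nu (8^n) = n + 1]. *)
Require Import Defs.
From mathcomp Require Import all_boot.
From mathcomp Require Import all_order all_algebra finmap.
From mathcomp Require Import classical_sets cardinality.
From mathcomp Require Import zify ring.

Set Implicit Arguments.
Unset Strict Implicit.
Unset Printing Implicit Defensive.

Import Order.TTheory GRing.Theory Num.Theory.
Local Open Scope ring_scope.

Definition eisenstein_norm (a b : int) : int := a ^+ 2 + a * b + b ^+ 2.

Lemma F_factor (x y z : int) :
  F x y z = (x + y + z) * eisenstein_norm (y - x) (z - y).
Proof. by rewrite /F /eisenstein_norm; ring. Qed.

(** If exactly one of [a], [b] is odd, exactly one of the three terms is odd; if both are odd, all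
    three terms are. *)
Lemma eisenstein_norm_even (a b c : int) :
  eisenstein_norm a b = 2 * c -> exists u v, a = 2 * u /\ b = 2 * v.
Proof.
have half (u : int) : {v | u = 2 * v} + {v | u = 2 * v + 1}.
  have [e|e] := eqVneq (u %% 2)%Z 0; [left|right]; exists (u %/ 2)%Z; lia.
rewrite /eisenstein_norm.
by case: (half a) => -[u ->]; case: (half b) => -[v ->] h; first (by exists u, v);
  exfalso; nia.
Qed.

Lemma eisenstein_norm_eq1 (a b : int) : 0 <= a -> 0 <= b ->
  eisenstein_norm a b = 1 -> (a = 1 /\ b = 0) \/ (a = 0 /\ b = 1).
Proof. by rewrite /eisenstein_norm => a0 b0 h; nia. Qed.

(** The absolute value of [q] divides [2 ^ (3 * n)], so it is a power of 2; [0 <= q] excludes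
    [q = -1]. *)
Lemma divisor_pow8 (n : nat) (s q : int) : 0 <= q -> s * q = (8 ^ n)%N%:Z ->
  q = 1 \/ exists c, q = 2 * c.
Proof.
move=> q0 /(congr1 absz); rewrite abszM absz_nat => h.
have /(dvdn_pfactor _ _ (isT : prime 2)) [[|j] _ qE] :
    (`|q| %| 2 ^ (3 * n))%N by rewrite expnM -h dvdn_mull.
  by left; lia.
by right; exists (2 ^ j)%N%:Z; move: qE; rewrite expnS; lia.
Qed.

(** Since 8 is -1 modulo 3, the remainder alternates between 1 and 2. *)
Lemma pow8_divn3 (n : nat) : (8 ^ n = 3 * (8 ^ n %/ 3) + 1 + odd n)%N.
Proof. by elim: n => // n IHn; rewrite expnS /=; case: (odd n) IHn => /=; lia. Qed.

(** The successive differences are (0, 1) for even [n] and (1, 0) for odd [n], and by [pow8_divn3]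
    the coordinates sum to [8 ^ n]. *)
Definition odd_representation (n : nat) : int * int * int :=
  let x := (8 ^ n %/ 3)%N%:Z in (x, x + (odd n)%:Z, x + 1).

Definition double3 (t : int * int * int) : int * int * int :=
  let: (x, y, z) := t in (2 * x, 2 * y, 2 * z).

Lemma double3_inj : injective double3.
Proof. by move=> [[x y] z] [[x' y'] z'] [*]; congr (_, _, _); lia. Qed.

Lemma odd_representation_correct (n : nat) :
  representations (8 ^ n) (odd_representation n).
Proof.
have e := pow8_divn3 n.
split; rewrite ?F_factor /eisenstein_norm; case: (odd n) e => /=; lia.
Qed.

Lemma double3_representation (m : nat) (t : int * int * int) :
  representations m t -> representations (8 * m) (double3 t).
Proof.
case: t => [[x y] z] [x0 xy yz xz h]; split; [lia..|].
have -> : F (2 * x) (2 * y) (2 * z) = 8 * F x y z by rewrite /F; ring.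
by rewrite h; lia.
Qed.

(** The outer coordinates differ by 1 on the left, by an even number on the right. *)
Lemma odd_representation_neq_double3 (n : nat) (t : int * int * int) :
  odd_representation n <> double3 t.
Proof. by case: t => [[x y] z] [*]; lia. Qed.

Lemma representation_pow8 (n : nat) (t : int * int * int) :
  representations (8 ^ n) t ->
  t = odd_representation n \/
  exists k t', [/\ n = k.+1, t = double3 t' & representations (8 ^ k) t'].
Proof.
case: t => [[x y] z] [x0 xy yz xz]; rewrite F_factor => h.
have e := pow8_divn3 n.
have q0 : 0 <= eisenstein_norm (y - x) (z - y).
  by rewrite /eisenstein_norm; nia.
have [q1|[c qc]] := divisor_pow8 q0 h.
  left; rewrite q1 mulr1 in h.
  have a0 : 0 <= y - x by lia.
  have b0 : 0 <= z - y by lia.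
  (* The sum is [3 * x + 2] or [3 * x + 1] respectively; [e] rejects the wrong parity of [n] and
     fixes [x]. *)
  by case: (eisenstein_norm_eq1 a0 b0 q1) => -[aE bE];
    rewrite /odd_representation; case: (odd n) e => /= e;
    congr (_, _, _); lia.
right; have [u [v [uE vE]]] := eisenstein_norm_even qc.
(* The sum also divides [8 ^ n]. It is not 1, because [z - x] is positive and even, hence at least
   2. *)
have [s1|[d sd]] : x + y + z = 1 \/ exists d, x + y + z = 2 * d.
- by apply: (@divisor_pow8 n (eisenstein_norm (y - x) (z - y)));
    rewrite 1?mulrC //; lia.
- by lia.
case: n {e} h => [|n] h.
  by move: h; rewrite qc expn0; lia.
(* From [3 * x + 4 * u + 2 * v = 2 * d] one gets [x = 2 * w]. *)
exists n; pose w := d - 2 * u - v - x.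
exists (w, w + u, w + u + v); split=> //=.
  by congr (_, _, _); rewrite /w; lia.
split; rewrite /w; [lia..|]; move: h; rewrite expnS -F_factor.
have -> : F x y z = 8 * F w (w + u) (w + u + v).
  have [-> -> ->] : [/\ x = 2 * w, y = 2 * (w + u) & z = 2 * (w + u + v)].
    by rewrite /w; split; lia.
  by rewrite /F; ring.
by rewrite /w; lia.
Qed.

(** The induction carries an explicit finite set, on which [set_fsetK] lets [nu] be evaluated. *)
Lemma representations_pow8 (n : nat) :
  exists2 A : {fset int * int * int},
    representations (8 ^ n) = [set` A]%classic & #|` A| = n.+1.
Proof.
elim: n => [|n [A AE cA]].
  exists [fset odd_representation 0]%fset; last by rewrite cardfs1.
  apply/seteqP; split=> t /=; rewrite inE.
    by move=> /representation_pow8 [->|[k [t' []]]].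
  by move=> /eqP ->; exact: odd_representation_correct.
exists (odd_representation n.+1 |` [fset double3 t | t in A])%fset.
  apply/seteqP; split=> t /=; rewrite in_fset1U.
    move=> /representation_pow8 [->|[k [t' [[<-] -> ]]]]; first by rewrite eqxx.
    by rewrite AE /= => tA; rewrite in_imfset ?orbT.
  move=> /orP[/eqP ->|/imfsetP [t' /= tA ->]].
    exact: odd_representation_correct.
  by rewrite expnS; apply: double3_representation; rewrite AE.
rewrite cardfsU1 card_imfset /=; last exact: double3_inj.
have -> : odd_representation n.+1 \notin [fset double3 t | t in A]%fset.
  by apply/imfsetP => -[t _] /odd_representation_neq_double3.
by rewrite cA.
Qed.

Lemma nu_pow8 (n : nat) : nu (8 ^ n) = n.+1.
Proof.
by rewrite /nu; have [A -> cA] := representations_pow8 n; rewrite set_fsetK.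
Qed.

Theorem theorem1 (n : nat) (hn : (0 < n)%N) :
  exists k : nat, (0 < k)%N /\ nu k = n.
Proof.
by exists (8 ^ n.-1)%N; rewrite nu_pow8 prednK // expn_gt0.
Qed.
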